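(* Let $(M,P,g)$ be a Riemannian almost product $\mathcal{W}_3$-manifold, let $\nabla$ be the Levi-Civita connection of $g$ and let $\nabla'$ be the RPT-connection on $(M,P,g)$ with torsion $$T(x,y,z)=\tfrac12\{F(x,y,Pz)+F(y,z,Px)+F(z,x,Py)\}.$$ Then the scalar curvatures $\tau$ of $\nabla$ and $\tau'$ of $\nabla'$ are related by $$\tau=\tau'+\tfrac38\,\|\nabla P\|^2 .$$
   Context: A Riemannian almost product manifold $(M,P,g)$ is a differentiable manifold $M$ with a $(1,1)$-tensor field $P$ and a Riemannian metric $g$ such that $P^2x=x$, $g(Px,Py)=g(x,y)$; throughout $\mathrm{tr}\,P=0$. Put $F(x,y,z)=g((\nabla_xP)y,z)$. $(M,P,g)$ is a $\mathcal{W}_3$-manifold if $F(x,y,z)+F(y,z,x)+F(z,x,y)=0$ identically. For a linear connection $\nabla'$, $T(x,y)=\nabla'_xy-\nabla'_yx-[x,y]$ and $T(x,y,z)=g(T(x,y),z)$. An RPT-connection is a linear connection $\nabla'$ with $\nabla'P=\nabla'g=0$ whose torsion $T(x,y,z)$ is a 3-form. Thus here $\nabla'$ is given by $g(\nabla'_xy,z)=g(\nabla_xy,z)+\frac12T(x,y,z)$ with the stated $T$. Curvature: $R(x,y)z=\nabla_x\nabla_yz-\nabla_y\nabla_xz-\nabla_{[x,y]}z$, $R(x,y,z,w)=g(R(x,y)z,w)$; for a basis $\{e_i\}$ of $T_pM$ with inverse metric matrix $g^{ij}$, $\rho(y,z)=g^{ij}R(e_i,y,z,e_j)$ and $\tau=g^{ij}\rho(e_i,e_j)$.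 The quantities $R',\rho',\tau'$ are defined by the same formulas for $\nabla'$. The square norm is $\|\nabla P\|^2=g^{ij}g^{ks}g((\nabla_{e_i}P)e_k,(\nabla_{e_j}P)e_s)$. *)

(* Defs.v *)
From HB Require Import structures.
From mathcomp Require Import all_boot all_order all_algebra.
From mathcomp Require Import all_classical all_reals all_analysis.

Set Implicit Arguments.
Unset Strict Implicit.
Unset Printing Implicit Defensive.

Import Order.TTheory GRing.Theory Num.Theory.
Import numFieldNormedType.Exports.

Local Open Scope classical_set_scope.
Local Open Scope ring_scope.

(* [partials s f] is the iterated partial derivative of f along the coordinate
   directions listed in s.  A map is C^oo near x when all its iterated partial
   derivatives are differentiable at every point of a neighbourhood of x. *)
Definition partials (R : realType) (n : nat) (W : normedModType R)
    (s : seq 'I_n) (f : 'rV[R]_n -> W) : 'rV[R]_n -> W :=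
  foldr (fun i h => fun x => 'D_(delta_mx 0 i) h x) f s.

Definition smooth_near (R : realType) (n : nat) (W : normedModType R)
    (x : 'rV[R]_n) (f : 'rV[R]_n -> W) : Prop :=
  \forall y \near x, forall s : seq 'I_n, differentiable (partials s f) y.

(* [chart_inv i] is only meaningful on the image of [chart i].  Since chart
   domains are open, continuity and smoothness at their points are ordinary
   (unrestricted) continuity and smoothness.  [chart_at] singles out one chart
   around each point; it serves to represent tangent vectors. *)
Record manifold (R : realType) (n : nat) := Manifold {
  mfd_space :> topologicalType;
  mfd_hausdorff : hausdorff_space mfd_space;
  mfd_second_countable : @second_countable mfd_space;
  mfd_index : Type;
  chart_dom : mfd_index -> set mfd_space;
  chart : mfd_index -> mfd_space -> 'rV[R]_n;
  chart_inv : mfd_index -> 'rV[R]_n -> mfd_space;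
  chart_at : mfd_space -> mfd_index;
  chart_at_dom : forall p, chart_dom (chart_at p) p;
  chart_dom_open : forall i, open (chart_dom i);
  chart_cod_open : forall i, open (chart i @` chart_dom i);
  chartK : forall i p, chart_dom i p -> chart_inv i (chart i p) = p;
  chart_continuous : forall i p, chart_dom i p ->
    {for p, continuous (chart i)};
  chart_inv_continuous : forall i p, chart_dom i p ->
    {for chart i p, continuous (chart_inv i)};
  chart_smooth : forall i j p, chart_dom i p -> chart_dom j p ->
    smooth_near (chart i p) (chart j \o chart_inv i)
}.

Section Manifold.
Variables (R : realType) (n : nat) (M : manifold R n).

(* T_pM is represented by 'rV[R]_n: a tangent vector at p is the row of its
   components in the chart [chart_at p].  Hence a vector field is a function
   M -> 'rV[R]_n, but its smoothness has to be read in a fixed chart.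
   [change i j q] turns components at q in chart i into components in chart j. *)
Definition vfield : Type := M -> 'rV[R]_n.

Definition change (i j : mfd_index M) (q : M) (v : 'rV[R]_n) : 'rV[R]_n :=
  'd (chart j \o chart_inv i) (chart i q) v.

Definition local_rep (i : mfd_index M) (X : vfield) (x : 'rV[R]_n) :
    'rV[R]_n :=
  let q := chart_inv i x in change (chart_at q) i q (X q).

(* Smoothness in a neighbourhood of p; all objects below act on vector fields
   that are smooth near the point under consideration. *)
Definition smooth_fun_at (p : M) (f : M -> R) : Prop :=
  smooth_near (chart (chart_at p) p)
    (f \o chart_inv (chart_at p) : 'rV[R]_n -> R^o).

Definition smooth_field_at (p : M) (X : vfield) : Prop :=
  smooth_near (chart (chart_at p) p) (local_rep (chart_at p) X).

(* The derivative v(f) of a function along v in T_pM. *)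
Definition dderiv (p : M) (v : 'rV[R]_n) (f : M -> R) : R :=
  'D_v (f \o chart_inv (chart_at p) : 'rV[R]_n -> R^o) (chart (chart_at p) p).

(* [X, Y]^k = X^a d_a Y^k - Y^a d_a X^k in the chart at p. *)
Definition bracket (X Y : vfield) : vfield := fun p =>
  let c := chart_at p in
  'D_(X p) (local_rep c Y) (chart c p) - 'D_(Y p) (local_rep c X) (chart c p).

(* The local vector field extending v in T_pM whose components in the chart
   [chart_at p] are constant; it is used to evaluate on tangent vectors the
   tensors that are given by formulas in vector fields. *)
Definition extend (p : M) (v : 'rV[R]_n) : vfield := fun q =>
  change (chart_at p) (chart_at q) q v.

Record metric := Metric {
  metric_fun :> M -> 'rV[R]_n -> 'rV[R]_n -> R;
  metric_linear : forall p a u v w,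
    metric_fun p (a *: u + v) w = a * metric_fun p u w + metric_fun p v w;
  metric_sym : forall p u v, metric_fun p u v = metric_fun p v u;
  metric_pos : forall p v, v != 0 -> 0 < metric_fun p v v;
  metric_smooth : forall p X Y, smooth_field_at p X -> smooth_field_at p Y ->
    smooth_fun_at p (fun q => metric_fun q (X q) (Y q))
}.

Record tensor11 := Tensor11 {
  tensor11_fun :> M -> {linear 'rV[R]_n -> 'rV[R]_n};
  tensor11_smooth : forall p X, smooth_field_at p X ->
    smooth_field_at p (fun q => tensor11_fun q (X q))
}.

(* A linear connection as a covariant derivative: [D p v Y] is the derivative
   at p, along v in T_pM, of a vector field Y smooth near p.  Locality in Y
   follows from [conn_leibniz] (f may be a cutoff that is locally constant
   near p), and no condition is put on fields that are not smooth near p. *)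
Record connection := Connection {
  conn_fun :> M -> 'rV[R]_n -> vfield -> 'rV[R]_n;
  conn_linear : forall p a u v Y, smooth_field_at p Y ->
    conn_fun p (a *: u + v) Y = a *: conn_fun p u Y + conn_fun p v Y;
  conn_add : forall p v Y Z, smooth_field_at p Y -> smooth_field_at p Z ->
    conn_fun p v (fun q => Y q + Z q) = conn_fun p v Y + conn_fun p v Z;
  conn_leibniz : forall p v f Y, smooth_fun_at p f -> smooth_field_at p Y ->
    conn_fun p v (fun q => f q *: Y q) =
      dderiv p v f *: Y p + f p *: conn_fun p v Y;
  conn_smooth : forall p X Y, smooth_field_at p X -> smooth_field_at p Y ->
    smooth_field_at p (fun q => conn_fun q (X q) Y)
}.

Definition nabla (D : connection) (X Y : vfield) : vfield :=
  fun p => D p (X p) Y.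

Definition torsion (D : connection) (X Y : vfield) : vfield :=
  fun p => nabla D X Y p - nabla D Y X p - bracket X Y p.

Definition torsion3 (g : metric) (D : connection) (X Y Z : vfield) (p : M) :
    R :=
  g p (torsion D X Y p) (Z p).

Definition curvature (D : connection) (X Y Z : vfield) : vfield := fun p =>
  nabla D X (nabla D Y Z) p - nabla D Y (nabla D X Z) p
    - nabla D (bracket X Y) Z p.

Definition parallel_metric (D : connection) (g : metric) : Prop :=
  forall p v Y Z, smooth_field_at p Y -> smooth_field_at p Z ->
    dderiv p v (fun q => g q (Y q) (Z q)) =
      g p (D p v Y) (Z p) + g p (Y p) (D p v Z).

Definition levi_civita (g : metric) (D : connection) : Prop :=
  parallel_metric D g /\
  forall p X Y, smooth_field_at p X -> smooth_field_at p Y ->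
    torsion D X Y p = 0.

(* (nabla_v P) Y *)
Definition nablaP (D : connection) (P : tensor11) (p : M) (v : 'rV[R]_n)
    (Y : vfield) : 'rV[R]_n :=
  D p v (fun q => P q (Y q)) - P p (D p v Y).

Definition tensorF (g : metric) (P : tensor11) (D : connection)
    (X Y Z : vfield) (p : M) : R :=
  g p (nablaP D P p (X p) Y) (Z p).

Definition app_field (P : tensor11) (X : vfield) : vfield := fun p => P p (X p).

Definition almost_product (g : metric) (P : tensor11) : Prop :=
  (forall p x, P p (P p x) = x) /\
  (forall p x y, g p (P p x) (P p y) = g p x y).

Definition traceless (P : tensor11) : Prop :=
  forall p, \tr (lin1_mx (P p)) = 0.

(* D is meant to be the Levi-Civita connection of g. *)
Definition W3 (g : metric) (P : tensor11) (D : connection) : Prop :=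
  forall p X Y Z,
    smooth_field_at p X -> smooth_field_at p Y -> smooth_field_at p Z ->
    tensorF g P D X Y Z p + tensorF g P D Y Z X p + tensorF g P D Z X Y p = 0.

(* Multilinearity of the torsion over functions is automatic; a 3-form is then
   an alternating tensor. *)
Definition torsion_3form (g : metric) (D : connection) : Prop :=
  forall p X Y Z,
    smooth_field_at p X -> smooth_field_at p Y -> smooth_field_at p Z ->
    torsion3 g D X Y Z p = - torsion3 g D Y X Z p /\
    torsion3 g D X Y Z p = - torsion3 g D X Z Y p.

Definition RPT (g : metric) (P : tensor11) (D : connection) : Prop :=
  [/\ forall p v Y, smooth_field_at p Y -> nablaP D P p v Y = 0,
      parallel_metric D g &
      torsion_3form g D].

Definition curv4 (g : metric) (D : connection) (p : M)
    (x y z w : 'rV[R]_n) : R :=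
  g p (curvature D (extend p x) (extend p y) (extend p z) p) w.

Definition is_basis (e : 'I_n -> 'rV[R]_n) : Prop :=
  row_free (\matrix_(i < n) e i).

(* g^{ij} at p with respect to e *)
Definition ginv (g : metric) (p : M) (e : 'I_n -> 'rV[R]_n) : 'M[R]_n :=
  invmx (\matrix_(i < n, j < n) g p (e i) (e j)).

Definition ricci (g : metric) (D : connection) (p : M)
    (e : 'I_n -> 'rV[R]_n) (y z : 'rV[R]_n) : R :=
  \sum_(i < n) \sum_(j < n) ginv g p e i j * curv4 g D p (e i) y z (e j).

(* As tau and the square norm below are contractions of tensors, they do not
   depend on the basis e of T_pM used to compute them. *)
Definition scalar_curvature (g : metric) (D : connection) (p : M)
    (e : 'I_n -> 'rV[R]_n) : R :=
  \sum_(i < n) \sum_(j < n) ginv g p e i j * ricci g D p e (e i) (e j).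

Definition sqnorm_nablaP (g : metric) (P : tensor11) (D : connection) (p : M)
    (e : 'I_n -> 'rV[R]_n) : R :=
  \sum_(i < n) \sum_(j < n) \sum_(k < n) \sum_(s < n)
    ginv g p e i j * ginv g p e k s *
    g p (nablaP D P p (e i) (extend p (e k)))
        (nablaP D P p (e j) (extend p (e s))).

End Manifold.

(* Main.v *)
Require Import Defs.
From mathcomp Require Import all_boot all_order all_algebra.
From mathcomp Require Import all_classical all_reals all_analysis.
From mathcomp Require Import ring lra.
Import Order.TTheory GRing.Theory Num.Theory.
Import numFieldNormedType.Exports.
Local Open Scope classical_set_scope.
Local Open Scope ring_scope.

Set Implicit Arguments.
Unset Strict Implicit.
Unset Printing Implicit Defensive.

(* Write D' = D + S.  Since both connections are metric, S(x,y,z) is skew in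
   (y,z), and a connection difference of this kind with torsion a 3-form T is
   S = T/2.  In the double trace of R' - R the derivatives of S and the terms
   linear in S drop out by skewness, leaving -|S|^2, so tau = tau' + |T|^2/4.
   It remains to see that |T|^2 = (3/2) |F|^2.  Put A(x,y,z) = F(x,y,Pz), so
   that |A| = |F| and T is half the cyclic sum of A.  Pairing the W3 identity
   with F gives <F, cyc F> = -|F|^2/2, while F(x,Py,z) = -F(x,y,Pz) gives
   <A, cyc A> = -<F, cyc F>; hence |T|^2 = (3|A|^2 + 6<A, cyc A>)/4
   = (3/2) |F|^2. *)

(** * Smooth maps on row vectors *)

(** The difference [g - f] vanishes near [x], so its expansion there holds with the zero map as
    linear part. *)
Lemma near_eq_differentiable (R : realType) (V W : normedModType R)
    (f g : V -> W) x :
  (\near x, f x = g x) -> differentiable f x -> differentiable g x.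
Proof.
move=> fg df; set h := g - f.
suff dh : differentiable h x.
  have -> : g = f + h by rewrite /h addrC subrK.
  exact: differentiableD.
pose z : {linear V -> W} := \0.
have z0 : continuous z by exact: cst_continuous.
have hz : h \o shift x = cst (h x) + z +o_ 0 id.
  apply/eqaddoP => e e0; near=> y.
  have -> : (h \o shift x - (cst (h x) + z)) y = 0.
    rewrite /h !fctE /= (nbhs_singleton fg) subrr !addr0 subr0.
    suff -> : f (y + x) = g (y + x) by rewrite subrr.
    near: y; have := fg; rewrite (near_shift 0 x) subr0; exact.
  by rewrite normr0 mulr_ge0 // ltW.
by apply/diff_locallyP; rewrite (diff_unique z0 hz).
Unshelve. all: by end_near. Qed.

Section SmoothOn.
Variables (R : realType) (n : nat).
Local Notation V := 'rV[R]_n.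

Definition smooth_on (W : normedModType R) (U : set V) (f : V -> W) : Prop :=
  forall s y, U y -> differentiable (partials s f) y.

Lemma partials_cat (W : normedModType R) (s t : seq 'I_n) (f : V -> W) :
  partials (s ++ t) f = partials s (partials t f).
Proof. by rewrite /partials foldr_cat. Qed.

Lemma smooth_nearP (W : normedModType R) (x : V) (f : V -> W) :
  smooth_near x f <-> exists U, [/\ open U, U x & smooth_on U f].
Proof.
split=> [|[U [oU Ux fU]]].
  rewrite /smooth_near /prop_near1 nbhsE => -[U [oU Ux] UP].
  by exists U; split=> // s y /UP.
rewrite /smooth_near /prop_near1 nbhsE.
by exists U => // y Uy s; exact: fU.
Qed.

Lemma open_eq_near (W : Type) (U : set V) (f g : V -> W) y :
  open U -> (forall y, U y -> f y = g y) -> U y -> \near y, f y = g y.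
Proof. by move=> oU fg Uy; apply: filterS (open_nbhs_nbhs (conj oU Uy)). Qed.

(** Invariant-class principle for smoothness. Stability under partial derivatives is asked only up
    to agreement on [U], because the differentiation rules are available only there. *)
Lemma smooth_on_coinduction (W : normedModType R) (U : set V)
    (A : (V -> W) -> Prop) : open U ->
  (forall h, A h -> forall y, U y -> differentiable h y) ->
  (forall h i, A h -> exists2 h', A h' &
     forall y, U y -> 'D_(delta_mx 0 i) h y = h' y) ->
  forall h, A h -> smooth_on U h.
Proof.
move=> oU Adiff Ader h0 Ah0 s.
(* The claim is generalized to functions agreeing on [U] with a member of [A]. The list is peeled
   from its end, where [foldr] has the first derivative taken. *)
have : exists2 h, A h & forall y, U y -> h y = h0 y by exists h0.
elim/last_ind: s h0 {Ah0} => [|s i IH] h0 [h Ah hh0] y Uy.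
  apply: near_eq_differentiable (Adiff _ Ah y Uy).
  exact: open_eq_near hh0 Uy.
rewrite -cats1 partials_cat /=; apply: IH => //.
have [h' Ah' hh'] := Ader h i Ah; exists h' => // z Uz.
rewrite -hh' //; apply: near_eq_derive; exact: open_eq_near hh0 Uz.
Qed.

Lemma smooth_on_eq (W : normedModType R) (U : set V) (f g : V -> W) :
  open U -> (forall y, U y -> f y = g y) -> smooth_on U f -> smooth_on U g.
Proof.
move=> oU fg Uf.
apply: (@smooth_on_coinduction _ _
  (fun h => exists2 h0, smooth_on U h0 & forall y, U y -> h0 y = h y)) => //.
- move=> h [h0 h0U h0h] y Uy; apply: near_eq_differentiable (h0U [::] y Uy).
  exact: open_eq_near h0h Uy.
- move=> h i [h0 h0U h0h]; exists ('D_(delta_mx 0 i) h); last by [].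
  exists ('D_(delta_mx 0 i) h0).
    by move=> s y Uy; have := h0U (rcons s i) y Uy; rewrite -cats1 partials_cat.
  by move=> y Uy; apply: near_eq_derive; exact: open_eq_near h0h Uy.
- by exists f.
Qed.

Lemma smooth_on_derive (W : normedModType R) (U : set V) (f : V -> W) i :
  smooth_on U f -> smooth_on U ('D_(delta_mx 0 i) f).
Proof.
by move=> Uf s y Uy; have := Uf (rcons s i) y Uy; rewrite -cats1 partials_cat.
Qed.

Lemma smooth_on_cst (W : normedModType R) (U : set V) (a : W) :
  open U -> smooth_on U (cst a).
Proof.
move=> oU; apply: (@smooth_on_coinduction _ _
  (fun h => exists b, h = cst b)) => //; last by exists a.
- by move=> _ [b ->] y _; exact: differentiable_cst.
- move=> _ i [b ->]; exists (cst 0); first by exists 0.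
  by move=> y _; rewrite derive_cst.
Qed.

Inductive alg_gen (B : (V -> R^o) -> Prop) : (V -> R^o) -> Prop :=
| Alg_base f of B f : alg_gen B f
| Alg_add f h of alg_gen B f & alg_gen B h : alg_gen B (f + h)
| Alg_mul f h of alg_gen B f & alg_gen B h : alg_gen B (f * h).

(** By the sum and Leibniz rules the generated algebra inherits both conditions of
    [smooth_on_coinduction] from its generators. *)
Lemma smooth_on_alg (U : set V) (B : (V -> R^o) -> Prop) : open U ->
  (forall h, B h -> forall y, U y -> differentiable h y) ->
  (forall h i, B h -> exists2 h', alg_gen B h' &
     forall y, U y -> 'D_(delta_mx 0 i) h y = h' y) ->
  forall h, alg_gen B h -> smooth_on U h.
Proof.
move=> oU Bdiff Bder.
have Ad h : alg_gen B h -> forall y, U y -> differentiable h y.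
  elim=> {h}[h /Bdiff//|f h _ fU _ hU y Uy|f h _ fU _ hU y Uy].
    by apply: differentiableD; auto.
  by apply: differentiableM; auto.
apply: smooth_on_coinduction => // h i.
elim=> {h}[h /Bder|f h Af [f' Af' ff'] Ah [h' Ah' hh']|
  f h Af [f' Af' ff'] Ah [h' Ah' hh']]; first exact.
- exists (f' + h'); first exact: Alg_add.
  move=> y Uy; rewrite deriveD; last 2 first.
  + exact/diff_derivable/Ad.
  + exact/diff_derivable/Ad.
  by rewrite ff' // hh'.
- exists (f * h' + h * f').
    by apply: Alg_add; apply: Alg_mul.
  move=> y Uy; rewrite deriveM; last 2 first.
  + exact/diff_derivable/Ad.
  + exact/diff_derivable/Ad.
  by rewrite ff' // hh'.
Qed.

Lemma alg_gen_sum (B : (V -> R^o) -> Prop) (F : 'I_n -> V -> R^o) :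
  B 0 -> (forall i, alg_gen B (F i)) -> alg_gen B (\sum_i F i).
Proof.
move=> B0 BF; elim/big_ind: _ => [|f h|i _]; first exact: Alg_base.
- exact: Alg_add.
- exact: BF.
Qed.

Lemma derive_coord (f : V -> V) j v y : differentiable f y ->
  'D_v (fun x => f x 0 j : R^o) y = ('D_v f y) 0 j.
Proof.
move=> df; rewrite derive_mx ?mxE //; exact: diff_derivable.
Qed.

Lemma smooth_on_coord (U : set V) (f : V -> V) j : open U -> smooth_on U f ->
  smooth_on U (fun x => f x 0 j : R^o).
Proof.
move=> oU fU; apply: (@smooth_on_coinduction R^o U (fun h => exists2 f : V -> V,
  smooth_on U f & h = fun x => f x 0 j)) => //.
- move=> _ [h hU ->] y Uy.
  apply: (@differentiable_comp _ _ _ _ h (fun N : V => N 0 j : R^o)).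
    exact: (hU [::]).
  exact: differentiable_coord.
- move=> _ i [h hU ->]; exists (fun x => ('D_(delta_mx 0 i) h x) 0 j).
    by exists ('D_(delta_mx 0 i) h) => //; exact: smooth_on_derive.
  by move=> y Uy; rewrite derive_coord //; exact: (hU [::]).
- by exists f.
Qed.

Lemma coord_differentiable (f : V -> V) y :
  (forall j, differentiable (fun x => f x 0 j : R^o) y) -> differentiable f y.
Proof.
move=> df.
have -> : f = \sum_j (fun x => f x 0 j *: (delta_mx 0 j : V)).
  by apply/funext => x; rewrite fct_sumE -row_sum_delta.
apply: differentiable_sum => j.
exact: differentiableZl (df j).
Qed.

Lemma smooth_on_rV (U : set V) (f : V -> V) : open U ->
  (forall j, smooth_on U (fun x => f x 0 j : R^o)) -> smooth_on U f.
Proof.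
move=> oU Uf; apply: (@smooth_on_coinduction V U
  (fun f : V -> V => forall j, smooth_on U (fun x => f x 0 j : R^o))) => //.
- by move=> h hU y Uy; apply: coord_differentiable => j; exact: (hU j [::]).
- move=> h i hU; exists ('D_(delta_mx 0 i) h) => // j.
  apply: smooth_on_eq (smooth_on_derive i (hU j)) => // y Uy.
  rewrite derive_coord //; apply: coord_differentiable => k.
  exact: (hU k [::]).
Qed.

Lemma derive_comp (f : V -> R^o) (psi : V -> V) v y :
  differentiable psi y -> differentiable f (psi y) ->
  'D_v (f \o psi) y = \sum_j ('D_v psi y) 0 j * 'D_(delta_mx 0 j) f (psi y).
Proof.
move=> dpsi df; rewrite deriveE; last exact: differentiable_comp.
rewrite diff_comp //= -(deriveE v dpsi) [X in 'd f _ X]row_sum_delta linear_sum.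
by apply: eq_bigr => j _; rewrite linearZ -deriveE.
Qed.

(** The two kinds of factors in the chain rule: partial derivatives of [psi], which are smooth on
    [U], and pullbacks along [psi] of derivatives of [f]. *)
Inductive comp_base (U : set V) (psi : V -> V) : (V -> R^o) -> Prop :=
| Comp_smooth a of smooth_on U a : comp_base U psi a
| Comp_pull U' f of smooth_on U' f & (forall y, U y -> U' (psi y)) :
    comp_base U psi (f \o psi).

(* By the chain rule this algebra is stable under partial derivatives. *)
Lemma smooth_on_comp_alg (U : set V) (psi : V -> V) :
  open U -> smooth_on U psi ->
  forall h, alg_gen (comp_base U psi) h -> smooth_on U h.
Proof.
move=> oU psiU; apply: smooth_on_alg => //.
- move=> _ [a aU y Uy|U' f fU' UU' y Uy]; first exact: (aU [::]).
  apply: differentiable_comp; first exact: (psiU [::]).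
  by apply: (fU' [::]); exact: UU'.
- move=> _ i [a aU|U' f fU' UU'].
    exists ('D_(delta_mx 0 i) a) => //; apply: Alg_base.
    by apply: Comp_smooth; exact: smooth_on_derive.
  exists (\sum_j (fun x => ('D_(delta_mx 0 i) psi x) 0 j : R^o) *
          ('D_(delta_mx 0 j) f \o psi)).
    apply: alg_gen_sum => [|j]; first by apply/Comp_smooth/smooth_on_cst.
    apply: Alg_mul; apply: Alg_base.
      by apply/Comp_smooth/smooth_on_coord => //; exact: smooth_on_derive.
    by apply: (@Comp_pull _ _ U') => //; exact: smooth_on_derive.
  move=> y Uy; rewrite derive_comp; last 2 first.
  + exact: (psiU [::]).
  + by apply: (fU' [::]); exact: UU'.
  by rewrite fct_sumE.
Qed.

Lemma smooth_near_derive_comp (phi psi : V -> V) v x :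
  smooth_near x psi -> smooth_near (psi x) phi ->
  smooth_near x (fun y => 'D_v phi (psi y)).
Proof.
move=> /smooth_nearP[U [oU Ux psiU]] /smooth_nearP[U' [oU' Ux' phiU']].
pose O := U `&` psi @^-1` U'.
have oO : open O.
  rewrite openE => y [Uy U'y]; apply: filterI; first exact: open_nbhs_nbhs.
  apply: (differentiable_continuous (psiU [::] y Uy)).
  exact: open_nbhs_nbhs.
have psiO : smooth_on O psi by move=> s y [Uy _]; exact: psiU.
apply/smooth_nearP; exists O; split=> //.
apply: smooth_on_rV => // j.
(* Expanding [v] in the standard basis turns each component into a sum of constants times pullbacks
   of partial derivatives. *)
apply: (@smooth_on_eq _ _ (\sum_i (cst (v 0 i) : V -> R^o) *
  ((fun y => ('D_(delta_mx 0 i) phi y) 0 j : R^o) \o psi))) => //.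
  move=> y [Uy U'y]; have dphi := phiU' [::] _ U'y.
  rewrite fct_sumE deriveE // {2}[v]row_sum_delta linear_sum summxE.
  by apply: eq_bigr => i _; rewrite linearZ mxE /= -deriveE.
apply: (smooth_on_comp_alg oO psiO).
apply: alg_gen_sum => [|i]; first by apply/Comp_smooth/smooth_on_cst.
apply: Alg_mul; apply: Alg_base; first by apply/Comp_smooth/smooth_on_cst.
apply: (@Comp_pull _ _ U'); last by move=> y [].
by apply: smooth_on_coord => //; exact: smooth_on_derive.
Qed.

End SmoothOn.

(** * Charts and coordinate vector fields *)

Section Charts.
Variables (R : realType) (n : nat) (M : manifold R n).
Local Notation V := 'rV[R]_n.

Lemma smooth_near_differentiable (W : normedModType R) (x : V) (f : V -> W) :
  smooth_near x f -> differentiable f x.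
Proof. by move=> /nbhs_singleton /(_ [::]). Qed.

Lemma smooth_near_eq (W : normedModType R) (x : V) (f g : V -> W) :
  (\near x, f x = g x) -> smooth_near x f -> smooth_near x g.
Proof.
rewrite {1}/prop_near1 nbhsE => -[N [oN Nx] fg] /smooth_nearP[U [oU Ux fU]].
apply/smooth_nearP; exists (U `&` N); split=> //; first exact: openI.
apply: (@smooth_on_eq _ _ _ _ f); first exact: openI.
- by move=> y [_ /fg].
- by move=> s y [Uy _]; exact: fU.
Qed.

Lemma near_eq_diff (W : normedModType R) (f g : V -> W) x v :
  (\near x, f x = g x) -> differentiable f x -> 'd f x v = 'd g x v.
Proof.
move=> fg df; rewrite -deriveE // (near_eq_derive _ fg) deriveE //.
exact: near_eq_differentiable df.
Qed.

Lemma near_chart (i : mfd_index M) (q : M) (Q : M -> Prop) :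
  chart_dom i q -> (\forall r \near q, Q r) ->
  \forall y \near chart i q, Q (chart_inv i y).
Proof.
move=> iq Qq; apply: (chart_inv_continuous iq).
by rewrite /= chartK.
Qed.

Lemma near_chart_dom (i : mfd_index M) (q : M) :
  chart_dom i q -> \forall r \near q, chart_dom i r.
Proof. by move=> iq; apply: open_nbhs_nbhs; split=> //; exact: chart_dom_open. Qed.

Lemma near_chart_invK (i : mfd_index M) (q : M) : chart_dom i q ->
  \forall y \near chart i q, chart i (chart_inv i y) = y.
Proof.
move=> iq; have : nbhs (chart i q) (chart i @` chart_dom i).
  by apply: open_nbhs_nbhs; split; [exact: chart_cod_open|exists q].
by apply: filterS => _ [r ir <-]; rewrite chartK.
Qed.

Lemma transition_differentiable (i j : mfd_index M) (q : M) :
  chart_dom i q -> chart_dom j q ->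
  differentiable (chart j \o chart_inv i) (chart i q).
Proof. by move=> iq jq; apply/smooth_near_differentiable/chart_smooth. Qed.

Lemma change_id (i : mfd_index M) (q : M) v :
  chart_dom i q -> change i i q v = v.
Proof.
move=> iq; rewrite /change (@near_eq_diff _ _ idfun).
- by rewrite diff_val.
- exact: near_chart_invK.
- exact: transition_differentiable.
Qed.

(** The separate base point [y] allows [chart j q] in place of the composite value
    [chart j (chart_inv i (chart i q))]. *)
Lemma diff_chain (f h : V -> V) x y v : f x = y ->
  differentiable f x -> differentiable h y ->
  'd h y ('d f x v) = 'd (h \o f) x v.
Proof.
move=> <- df dh; have := diff_comp df dh => /(congr1 (fun F : V -> V => F v)) H.
exact: (esym H).
Qed.

(** Near [chart i q] the inner [chart_inv j] and [chart j] cancel, so the chain rule gives the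
    cocycle identity. *)
Lemma change_comp (i j k : mfd_index M) (q : M) v :
  chart_dom i q -> chart_dom j q -> chart_dom k q ->
  change j k q (change i j q v) = change i k q v.
Proof.
move=> iq jq kq; rewrite /change.
have dij := transition_differentiable iq jq.
have djk := transition_differentiable jq kq.
have e : (chart j \o chart_inv i) (chart i q) = chart j q by rewrite /= chartK.
apply: (etrans (diff_chain v e dij djk)).
apply: near_eq_diff; last first.
  by apply: differentiable_comp => //; rewrite e.
apply: filterS (near_chart iq (near_chart_dom jq)) => y jy /=.
by rewrite chartK.
Qed.

(** [local_rep] and [extend] both pass through the chart chosen at the moving point; the cocycle
    identity eliminates it. *)
Lemma local_rep_extend (i : mfd_index M) (p q : M) v :
  chart_dom (chart_at p) q -> chart_dom i q ->
  \forall y \near chart i q,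
    local_rep i (extend p v) y = change (chart_at p) i (chart_inv i y) v.
Proof.
move=> pq iq.
apply: filterS2 (near_chart iq (near_chart_dom pq))
  (near_chart iq (near_chart_dom iq)) => y py iy.
by rewrite /local_rep /extend change_comp //; exact: chart_at_dom.
Qed.

(* [smooth_field_at q] reads the field in the chart at q, where [extend p v] has
   the components ['D_v phi \o psi] for the transition maps phi and psi between
   the two charts. *)
Lemma extend_smooth (p q : M) v :
  chart_dom (chart_at p) q -> smooth_field_at q (extend p v).
Proof.
move=> pq; rewrite /smooth_field_at.
have qq := chart_at_dom q; set j := chart_at q in qq *.
set i := chart_at p in pq *.
pose psi := chart i \o chart_inv j; pose phi := chart j \o chart_inv i.
apply: (@smooth_near_eq _ _ (fun y => 'D_v phi (psi y))).
  apply: filterS3 (near_chart qq (near_chart_dom qq))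
    (near_chart qq (near_chart_dom pq)) (local_rep_extend v pq qq) => y jy iy ->.
  by rewrite deriveE //; exact: transition_differentiable.
apply: smooth_near_derive_comp; first exact: chart_smooth.
by rewrite /psi /= chartK //; exact: chart_smooth.
Qed.

Lemma extend_at (p : M) v : extend p v p = v.
Proof. by rewrite /extend change_id //; exact: chart_at_dom. Qed.

(** In the chart at [p] both fields have constant components near that point. *)
Lemma bracket_extend (p : M) u v : bracket (extend p u) (extend p v) p = 0.
Proof.
have pp := chart_at_dom p.
suff D0 w w' : 'D_w (local_rep (chart_at p) (extend p w')) (chart (chart_at p) p) = 0.
  by rewrite /bracket !D0 subrr.
rewrite (@near_eq_derive _ _ _ _ (cst w')) ?derive_cst //.
apply: filterS2 (near_chart pp (near_chart_dom pp)) (local_rep_extend w' pp pp).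
by move=> y py ->; rewrite change_id.
Qed.

Lemma dderiv_near (p : M) v (f h : M -> R) :
  (\forall q \near p, f q = h q) -> dderiv p v f = dderiv p v h.
Proof.
move=> fh; apply: near_eq_derive; apply: (@near_chart _ _ (fun q => f q = h q)) => //.
exact: chart_at_dom.
Qed.

Lemma dderivD (p : M) v (f h : M -> R) :
  smooth_fun_at p f -> smooth_fun_at p h ->
  dderiv p v (fun q => f q + h q) = dderiv p v f + dderiv p v h.
Proof.
move=> /smooth_near_differentiable df /smooth_near_differentiable dh.
by rewrite -deriveD //; exact: diff_derivable.
Qed.

End Charts.

(** * Metric contractions *)

Section Contraction.
Variables (R : realType) (n : nat) (H : 'M[R]_n).

Definition contr (h : 'I_n -> 'I_n -> R) : R := \sum_i \sum_j H i j * h i j.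

Lemma eq_contr h1 h2 : (forall i j, h1 i j = h2 i j) -> contr h1 = contr h2.
Proof.
by move=> e; apply: eq_bigr => i _; apply: eq_bigr => j _; rewrite e.
Qed.

Lemma contrD h1 h2 : contr (fun i j => h1 i j + h2 i j) = contr h1 + contr h2.
Proof.
rewrite /contr -big_split; apply: eq_bigr => i _ /=.
by rewrite -big_split; apply: eq_bigr => j _; rewrite /= mulrDr.
Qed.

Lemma contrZ c h : contr (fun i j => c * h i j) = c * contr h.
Proof.
rewrite /contr mulr_sumr; apply: eq_bigr => i _.
by rewrite mulr_sumr; apply: eq_bigr => j _; rewrite mulrCA.
Qed.

Lemma contrN h : contr (fun i j => - h i j) = - contr h.
Proof.
by rewrite -mulN1r -contrZ; apply: eq_contr => i j; rewrite mulN1r.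
Qed.

Lemma contr_exchange (h : 'I_n -> 'I_n -> 'I_n -> 'I_n -> R) :
  contr (fun i j => contr (fun k l => h i j k l)) =
  contr (fun k l => contr (fun i j => h i j k l)).
Proof.
rewrite /contr.
have pairE (f : 'I_n -> 'I_n -> R) : \sum_i \sum_j f i j = \sum_u f u.1 u.2.
  by rewrite pair_big.
rewrite !pairE.
under eq_bigr do rewrite pairE mulr_sumr.
under [RHS]eq_bigr do rewrite pairE mulr_sumr.
rewrite exchange_big; apply: eq_bigr => u _; apply: eq_bigr => v _.
by rewrite mulrCA.
Qed.

(* The metric pairing of two covariant 3-tensors given by their components. *)
Definition ip3 (A B : 'I_n -> 'I_n -> 'I_n -> R) : R :=
  contr (fun i j => contr (fun k l => contr (fun m r => A i k m * B j l r))).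

Lemma eq_ip3 A A' B B' : (forall i j k, A i j k = A' i j k) ->
  (forall i j k, B i j k = B' i j k) -> ip3 A B = ip3 A' B'.
Proof.
move=> eA eB; apply: eq_contr => i j; apply: eq_contr => k l.
by apply: eq_contr => m r; rewrite eA eB.
Qed.

Lemma ip3Dr A B C :
  ip3 A (fun i j k => B i j k + C i j k) = ip3 A B + ip3 A C.
Proof.
rewrite /ip3 -contrD; apply: eq_contr => i j.
rewrite -contrD; apply: eq_contr => k l.
by rewrite -contrD; apply: eq_contr => m r; rewrite mulrDr.
Qed.

Lemma ip3Zr c A B : ip3 A (fun i j k => c * B i j k) = c * ip3 A B.
Proof.
rewrite /ip3 -contrZ; apply: eq_contr => i j.
rewrite -contrZ; apply: eq_contr => k l.
by rewrite -contrZ; apply: eq_contr => m r; rewrite mulrCA.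
Qed.

Definition cyc (A : 'I_n -> 'I_n -> 'I_n -> R) i j k := A j k i.

(** Moving the outermost contraction past the other two is a cyclic renaming of the index pairs. *)
Lemma ip3_cyc A B : ip3 (cyc A) (cyc B) = ip3 A B.
Proof.
rewrite /ip3 contr_exchange; apply: eq_contr => i j.
by rewrite contr_exchange.
Qed.

Hypothesis H_sym : forall i j, H i j = H j i.

Lemma contr_sym h : contr h = contr (fun i j => h j i).
Proof.
rewrite /contr exchange_big; apply: eq_bigr => i _; apply: eq_bigr => j _.
by rewrite H_sym.
Qed.

Lemma ip3C A B : ip3 A B = ip3 B A.
Proof.
rewrite /ip3 contr_sym; apply: eq_contr => i j.
rewrite contr_sym; apply: eq_contr => k l.
by rewrite contr_sym; apply: eq_contr => m r; rewrite mulrC.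
Qed.

Lemma ip3Dl A B C :
  ip3 (fun i j k => A i j k + B i j k) C = ip3 A C + ip3 B C.
Proof. by rewrite ip3C ip3Dr !(ip3C C). Qed.

Lemma ip3Zl c A B : ip3 (fun i j k => c * A i j k) B = c * ip3 A B.
Proof. by rewrite ip3C ip3Zr ip3C. Qed.

(** [cyc] preserves the pairing and has order three, so <A, cyc^2 A> = <cyc A, A>. *)
Lemma ip3_cyc2 A : ip3 A (cyc (cyc A)) = ip3 A (cyc A).
Proof. by rewrite -ip3_cyc ip3C. Qed.

(** Of the nine pairings, the three diagonal ones equal <A, A> and the other six <A, cyc A>. *)
Lemma ip3_cyc_sum A (C := fun i j k => A i j k + cyc A i j k + cyc (cyc A) i j k) :
  ip3 C C = 3 * ip3 A A + 6 * ip3 A (cyc A).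
Proof.
have e1 : ip3 (cyc A) A = ip3 A (cyc A) by exact: ip3C.
have e2 : ip3 (cyc (cyc A)) A = ip3 A (cyc A) by rewrite ip3C; exact: ip3_cyc2.
have e3 : ip3 (cyc (cyc A)) (cyc A) = ip3 (cyc A) A by exact: ip3_cyc.
have e4 : ip3 (cyc A) (cyc (cyc A)) = ip3 A (cyc A) by exact: ip3_cyc.
have e5 : ip3 (cyc A) (cyc A) = ip3 A A by exact: ip3_cyc.
have e6 : ip3 (cyc (cyc A)) (cyc (cyc A)) = ip3 (cyc A) (cyc A) by exact: ip3_cyc.
rewrite /C !ip3Dr !ip3Dl (ip3_cyc2 A) e6 e5 e4 e3 e2 e1; ring.
Qed.

End Contraction.

(** * Parseval's identity and the norm of the torsion at a point *)

Section InnerProduct.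
Variables (R : realType) (n : nat).
Local Notation V := 'rV[R]_n.
Variable (b : V -> V -> R).
Hypothesis b_linear : forall a u v w, b (a *: u + v) w = a * b u w + b v w.
Hypothesis b_sym : forall u v, b u v = b v u.
Hypothesis b_pos : forall v, v != 0 -> 0 < b v v.

Lemma ipDl u v w : b (u + v) w = b u w + b v w.
Proof. by rewrite -[u]scale1r b_linear mul1r scale1r. Qed.

Lemma ip0l w : b 0 w = 0.
Proof. by have := ipDl 0 0 w; rewrite addr0; lra. Qed.

Lemma ipZl a u w : b (a *: u) w = a * b u w.
Proof. by rewrite -[a *: u]addr0 b_linear ip0l addr0. Qed.

Lemma ipNl u w : b (- u) w = - b u w.
Proof. by rewrite -scaleN1r ipZl mulN1r. Qed.

Lemma ipBl u v w : b (u - v) w = b u w - b v w.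
Proof. by rewrite ipDl ipNl. Qed.

Lemma ipDr u v w : b w (u + v) = b w u + b w v.
Proof. by rewrite b_sym ipDl !(b_sym w). Qed.

Lemma ipNr u w : b w (- u) = - b w u.
Proof. by rewrite b_sym ipNl b_sym. Qed.

Lemma ipBr u v w : b w (u - v) = b w u - b w v.
Proof. by rewrite ipDr ipNr. Qed.

Lemma ip_suml (I : finType) (c : I -> R) (u : I -> V) w :
  b (\sum_i c i *: u i) w = \sum_i c i * b (u i) w.
Proof.
by elim/big_rec2: _ => [|i x y _ <-]; [exact: ip0l|exact: b_linear].
Qed.

Lemma ip_inj u v : (forall w, b u w = b v w) -> u = v.
Proof.
move=> uv; apply/eqP; rewrite -subr_eq0; apply/negPn/negP => /b_pos.
by rewrite ipBl uv subrr ltxx.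
Qed.

Variable e : 'I_n -> V.
Hypothesis e_basis : is_basis e.

Let G : 'M[R]_n := \matrix_(i < n, j < n) b (e i) (e j).
Let H : 'M[R]_n := invmx G.

Lemma gram_sym : G^T = G.
Proof. by apply/matrixP => i j; rewrite !mxE b_sym. Qed.

Lemma gram_inv_sym i j : H i j = H j i.
Proof. by rewrite -[in RHS](trmxK H) [RHS]mxE /H trmx_inv gram_sym. Qed.

Lemma basis_coord (v : V) : exists c : V, v = \sum_i c 0 i *: e i.
Proof.
pose E := \matrix_(i < n) e i.
have uE : E \in unitmx by rewrite -row_free_unit.
exists (v *m invmx E); rewrite -[LHS](mulmxKV uE) mulmx_sum_row.
by apply: eq_bigr => i _; rewrite rowK.
Qed.

Lemma gram_mul (c : V) j : (c *m G) 0 j = b (\sum_i c 0 i *: e i) (e j).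
Proof. by rewrite ip_suml mxE; apply: eq_bigr => i _; rewrite mxE. Qed.

(** A row killed by [G] gives a vector orthogonal to every [e j], hence to itself; positivity makes
    the vector zero, and independence of [e] the row. *)
Lemma gram_unit : G \in unitmx.
Proof.
rewrite -row_free_unit; apply: inj_row_free => c cG.
have e0 : \sum_i c 0 i *: e i = 0.
  apply/eqP/negPn/negP => /b_pos; rewrite {2}/GRing.scale /=.
  rewrite b_sym ip_suml big1 ?ltxx // => i _.
  by rewrite b_sym -gram_mul cG mxE mulr0.
have : c *m (\matrix_i e i) = 0.
  by rewrite mulmx_sum_row -[RHS]e0; apply: eq_bigr => i _; rewrite rowK.
move/(congr1 (mulmx^~ (invmx (\matrix_i e i)))).
by rewrite mul0mx mulmxK // -row_free_unit.
Qed.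

Lemma parseval u v : contr H (fun i j => b u (e i) * b v (e j)) = b u v.
Proof.
have [a ->] := basis_coord u; have [c ->] := basis_coord v.
(* In coordinates the contraction is a matrix product in which [G] cancels against [H]. *)
transitivity ((a *m G *m H *m (c *m G)^T) 0 0).
  rewrite mxE /contr exchange_big /=; apply: eq_bigr => j _.
  rewrite mxE mulr_suml; apply: eq_bigr => i _.
  by rewrite [(c *m G)^T j 0]mxE !gram_mul mulrA [H i j * _]mulrC.
rewrite mulmxK ?gram_unit // ip_suml mxE; apply: eq_bigr => i _.
by rewrite [(c *m G)^T i 0]mxE gram_mul [in LHS]b_sym.
Qed.

Variable (P : V -> V).
Hypothesis PP : forall x, P (P x) = x.
Hypothesis bPP : forall x y, b (P x) (P y) = b x y.

Lemma ipPl x y : b (P x) y = b x (P y).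
Proof. by rewrite -bPP PP. Qed.

(** [P] is a self-adjoint isometry: it moves from the basis onto [u] and [v], where it drops out. *)
Lemma parsevalP u v :
  contr H (fun i j => b u (P (e i)) * b v (P (e j))) = b u v.
Proof.
rewrite -bPP -parseval; apply: eq_contr => i j.
by rewrite !ipPl.
Qed.

Variables (N S : V -> V -> V).
Hypothesis N_sym : forall x y z, b (N x y) z = b y (N x z).
Hypothesis N_P : forall x y, N x (P y) = - P (N x y).
Hypothesis N_cycle : forall x y z, b (N x y) z + b (N y z) x + b (N z x) y = 0.
Hypothesis S_N : forall x y z, b (S x y) z =
  4^-1 * (b (N x y) (P z) + b (N y z) (P x) + b (N z x) (P y)).

Let F i k m := b (N (e i) (e k)) (e m).

(** [N] stands for (x, y) -> (nabla_x P) y at a point and [S] for half the torsion, whence the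
    factor 1/4 in [S_N]. Then 3/8 = (3 + 6/2) / 16 by [ip3_cyc_sum]. *)
Lemma ip3_torsion :
  ip3 H (fun i k m => b (S (e i) (e k)) (e m))
        (fun i k m => b (S (e i) (e k)) (e m)) = 3 / 8 * ip3 H F F.
Proof.
have Hs := gram_inv_sym.
pose A i k m := b (N (e i) (e k)) (P (e m)).
(* [A] is [F] with [P] on its last slot, and contracting that slot removes both copies of [P]. The
   index functions let the first two slots be swapped in one factor. *)
have FA (x y : 'I_n -> 'I_n -> 'I_n) (x' y' : 'I_n -> 'I_n -> 'I_n) :
    ip3 H (fun i k m => A (x i k) (y i k) m) (fun i k m => A (x' i k) (y' i k) m)
  = ip3 H (fun i k m => F (x i k) (y i k) m) (fun i k m => F (x' i k) (y' i k) m).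
  apply: eq_contr => i j; apply: eq_contr => k l.
  by rewrite parsevalP parseval.
have AA : ip3 H A A = ip3 H F F.
  exact: (FA (fun i _ => i) (fun _ k => k) (fun i _ => i) (fun _ k => k)).
have FcF : ip3 H F (cyc F) = - 2^-1 * ip3 H F F.
  have : ip3 H F (fun i k m => F i k m + cyc F i k m + cyc (cyc F) i k m) = 0.
    rewrite (@eq_ip3 _ _ _ F F _ (fun i j k => 0 * F i j k)) ?ip3Zr ?mul0r //.
    by move=> i j k; rewrite mul0r; exact: N_cycle.
  by rewrite !ip3Dr (ip3_cyc2 Hs F); lra.
have AcA : ip3 H A (cyc A) = 2^-1 * ip3 H F F.
  (* [N_sym] and [N_P] turn [cyc A] into minus [A] with its first two slots swapped. *)
  rewrite (@eq_ip3 _ _ _ A A _ (fun i k m => -1 * A k i m)) //; last first.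
    by move=> i k m; rewrite /cyc /A N_sym N_P ipNr b_sym ipPl mulN1r.
  rewrite ip3Zr.
  have -> := FA (fun i _ => i) (fun _ k => k) (fun _ k => k) (fun i _ => i).
  rewrite (@eq_ip3 _ _ _ _ F _ (cyc F)) ?FcF //; first lra.
  by move=> i k m; rewrite /F /cyc [RHS]b_sym -N_sym.
pose C i k m := 4^-1 * (A i k m + cyc A i k m + cyc (cyc A) i k m).
rewrite (@eq_ip3 _ _ _ _ C _ C) => [|i k m|i k m]; [|exact: S_N|exact: S_N].
rewrite /C ip3Zr ip3Zl // (ip3_cyc_sum Hs A) AcA AA; lra.
Qed.

End InnerProduct.

(** * Metric connections *)

(** For the difference s of two connections, the letters a to f are s(X,Y,Z), s(Y,X,Z), s(Y,Z,X),
    s(Z,Y,X), s(Z,X,Y), s(X,Z,Y). Alternating skewness and torsion relations yields a = t - a, as in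
    Koszul's formula. *)
Lemma half_skew (R : realType) (a b c d e f t : R) :
  a = - f -> b = - c -> e = - d -> a - b = t -> c - d = t -> e - f = t ->
  a = 2^-1 * t.
Proof. lra. Qed.

Section Connections.
Variables (R : realType) (n : nat) (M : manifold R n) (g : metric M).
Local Notation V := 'rV[R]_n.

Let gB p := ipBl (@metric_linear _ _ _ g p).
Let gBr p := ipBr (@metric_linear _ _ _ g p) (Defs.metric_sym g p).

Lemma smooth_extend p v : @smooth_field_at _ _ M p (extend p v).
Proof. by apply: extend_smooth; exact: chart_at_dom. Qed.

Lemma conn0 (D : connection M) p Y : smooth_field_at p Y -> D p 0 Y = 0.
Proof.
move=> sY; have := conn_linear D 1 0 0 sY.
by rewrite !scale1r addr0 => /eqP; rewrite -subr_eq subrr => /eqP.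
Qed.

(* The outer derivative is moved across the metric, so that comparing two
   connections only involves derivatives of functions and the components of
   the connections at p. *)
Lemma curv4E (D : connection M) p x y z w : parallel_metric D g ->
  let a x y := dderiv p x (fun q => g q (D q (extend p y q) (extend p z))
                                        (extend p w q)) in
  let G u v := D p u (extend p v) in
  curv4 g D p x y z w =
    a x y - a y x - g p (G y z) (G x w) + g p (G x z) (G y w).
Proof.
move=> gpar a G; rewrite /curv4 /curvature.
have [X Y Z W] : [/\ smooth_field_at p (extend p x),
    smooth_field_at p (extend p y),
    smooth_field_at p (extend p z) & smooth_field_at p (extend p w)].
  by split; exact: smooth_extend.
rewrite [nabla D (bracket _ _) _ p]/nabla bracket_extend conn0 // subr0 gB.
have aE u v : smooth_field_at p (extend p u) -> smooth_field_at p (extend p v) ->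
    g p (nabla D (extend p u) (nabla D (extend p v) (extend p z)) p) w =
      a u v - g p (G v z) (G u w).
  move=> U V'; rewrite /a gpar //; last exact: conn_smooth.
  by rewrite /nabla !extend_at /G addrK.
by rewrite !aE //; ring.
Qed.

(** * Comparison of a metric connection with the Levi-Civita connection *)

Section TorsionDifference.
Variables D D' : connection M.
Hypotheses (hD : levi_civita g D) (gD' : parallel_metric D' g).
Hypothesis (T3 : torsion_3form g D').

Lemma metric_connection_diff p X Y Z :
  smooth_field_at p X -> smooth_field_at p Y -> smooth_field_at p Z ->
  g p (D' p (X p) Y) (Z p) =
    g p (D p (X p) Y) (Z p) + 2^-1 * torsion3 g D' X Y Z p.
Proof.
move=> sX sY sZ; have [gpar tor0] := hD.
pose s X Y Z := g p (D' p (X p) Y) (Z p) - g p (D p (X p) Y) (Z p).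
have s_skew A B C : smooth_field_at p B -> smooth_field_at p C ->
    s A B C = - s A C B.
  move=> sB sC; have := gpar p (A p) B C sB sC.
  rewrite gD' // /s [g p (B p) _]Defs.metric_sym [X in _ = _ + X]Defs.metric_sym.
  lra.
have s_tor A B C : smooth_field_at p A -> smooth_field_at p B ->
    s A B C - s B A C = torsion3 g D' A B C p.
  move=> sA sB; have := congr1 (fun v => g p v (C p)) (tor0 p A B sA sB).
  rewrite (ip0l (@metric_linear _ _ _ g p)) /torsion3 /torsion /nabla !gB /s; lra.
have tyzx : torsion3 g D' Y Z X p = torsion3 g D' X Y Z p.
  by rewrite (T3 sX sY sZ).1 (T3 sY sX sZ).2 opprK.
have tzxy : torsion3 g D' Z X Y p = torsion3 g D' X Y Z p.
  by rewrite (T3 sX sY sZ).2 (T3 sX sZ sY).1 opprK.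
apply/eqP; rewrite addrC -subr_eq; apply/eqP.
apply: (half_skew (s_skew X Y Z sY sZ) (s_skew Y X Z sX sZ) (s_skew Z X Y sX sY)).
- exact: s_tor.
- by rewrite s_tor.
- by rewrite s_tor.
Qed.

(** The difference of the connections is half the torsion. Its skewness is assumed on a whole chart
    domain because it is differentiated at [p]. *)
Lemma dderiv_diff_skew p v X Y Z X' Y' Z' :
  (forall q, chart_dom (chart_at p) q ->
    [/\ smooth_field_at q X, smooth_field_at q Y & smooth_field_at q Z]) ->
  (forall q, chart_dom (chart_at p) q ->
    [/\ smooth_field_at q X', smooth_field_at q Y' & smooth_field_at q Z']) ->
  (forall q, chart_dom (chart_at p) q ->
    torsion3 g D' X Y Z q = - torsion3 g D' X' Y' Z' q) ->
  let a (D : connection M) X Y Z :=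
    dderiv p v (fun q => g q (D q (X q) Y) (Z q)) in
  a D' X Y Z - a D X Y Z = - (a D' X' Y' Z' - a D X' Y' Z').
Proof.
move=> sm sm' tt a; have pp := chart_at_dom p.
have [sX sY sZ] := sm p pp; have [sX' sY' sZ'] := sm' p pp.
(* Written with sums, the claim compares derivatives of two functions that agree near [p], the
   torsion terms cancelling. *)
suff : a D' X Y Z + a D' X' Y' Z' = a D X Y Z + a D X' Y' Z' by lra.
rewrite /a -!dderivD; do ?by apply: metric_smooth => //; exact: conn_smooth.
apply: dderiv_near; apply: filterS (near_chart_dom pp) => q pq.
have [qX qY qZ] := sm q pq; have [qX' qY' qZ'] := sm' q pq.
rewrite !metric_connection_diff // tt //; lra.
Qed.

Lemma scalar_curvature_diff p (e : 'I_n -> V) : is_basis e ->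
  let S i j m := g p (D' p (e i) (extend p (e j)) - D p (e i) (extend p (e j)))
                     (e m) in
  scalar_curvature g D p e =
    scalar_curvature g D' p e + ip3 (ginv g p e) S S.
Proof.
move=> be S3; set H := ginv g p e.
have gl := @metric_linear _ _ _ g p; have gs := Defs.metric_sym g p.
have gp := @metric_pos _ _ _ g p.
have Hs : forall i j, H i j = H j i by exact: (gram_inv_sym gs).
have pp := chart_at_dom p.
have sm u q : chart_dom (chart_at p) q -> smooth_field_at q (extend p u).
  exact: extend_smooth.
pose G i j := D p (e i) (extend p (e j)).
pose G' i j := D' p (e i) (extend p (e j)).
pose S i j := G' i j - G i j.
(* Derivatives of the Christoffel symbols with lowered index; [s] is their difference, the
   derivative of half the torsion. *)
pose a (D : connection M) k i j l := dderiv p (e k) (fun q =>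
  g q (D q (extend p (e i) q) (extend p (e j))) (extend p (e l) q)).
pose s k i j l := a D' k i j l - a D k i j l.
have s12 k i j l : s k i j l = - s k j i l.
  apply: dderiv_diff_skew; do ?by move=> q pq; split; exact: sm.
  by move=> q pq; have [->] := T3 (sm (e i) q pq) (sm (e j) q pq) (sm (e l) q pq).
have s23 k i j l : s k i j l = - s k i l j.
  apply: dderiv_diff_skew; do ?by move=> q pq; split; exact: sm.
  by move=> q pq; have [_ ->] := T3 (sm (e i) q pq) (sm (e j) q pq) (sm (e l) q pq).
have s13 k i j l : s k i j l = - s k l j i.
  by rewrite s12 s23 s12 opprK.
have SE i j m : g p (S i j) (e m) =
    2^-1 * torsion3 g D' (extend p (e i)) (extend p (e j)) (extend p (e m)) p.
  have := metric_connection_diff (sm (e i) p pp) (sm (e j) p pp) (sm (e m) p pp).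
  by rewrite !extend_at /S gB /G /G'; lra.
have inj u v : (forall m, g p u (e m) = g p v (e m)) -> u = v.
  move=> uv; apply: (ip_inj gl gp) => w.
  rewrite -[LHS](parseval gl gs gp be) -[RHS](parseval gl gs gp be).
  by apply: eq_contr => i j; rewrite uv.
have SN i j : S i j = - S j i.
  apply: inj => m; rewrite (ipNl gl) !SE.
  have [-> _] := T3 (sm (e i) p pp) (sm (e j) p pp) (sm (e m) p pp).
  by rewrite mulrN.
(* Coordinate fields commute and [D] is torsion-free. *)
have GC i j : G i j = G j i.
  have := hD.2 p _ _ (sm (e i) p pp) (sm (e j) p pp).
  by rewrite /torsion bracket_extend /nabla !extend_at subr0 => /subr0_eq.
(* Substitute G' = G + S. A factor [G'] may stay in the first product, where [S] will be traced over
   its own two indices; the second is expanded fully to isolate the quadratic term. *)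
have curvE i j k l : curv4 g D' p (e k) (e i) (e j) (e l) =
    curv4 g D p (e k) (e i) (e j) (e l) + (s k i j l - s i k j l
    - (g p (S i j) (G' k l) + g p (G i j) (S k l))
    + (g p (S k j) (G i l) + g p (S i l) (G k j)) + g p (S k j) (S i l)).
  have E D0 : parallel_metric D0 g -> curv4 g D0 p (e k) (e i) (e j) (e l) =
      a D0 k i j l - a D0 i k j l
      - g p (D0 p (e i) (extend p (e j))) (D0 p (e k) (extend p (e l)))
      + g p (D0 p (e k) (extend p (e j))) (D0 p (e i) (extend p (e l))).
    exact: curv4E.
  rewrite (E D' gD') (E D hD.1) -!/(G _ _) -!/(G' _ _) /s.
  have GE k' l' : G' k' l' = G k' l' + S k' l' by rewrite /S addrC subrK.
  rewrite !GE; clearbody S.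
  rewrite !(ipDl gl) !(ipDr gl gs) [g p (G k j) (S i l)]gs.
  ring.
pose cc (h : 'I_n -> 'I_n -> 'I_n -> 'I_n -> R) :=
  contr H (fun i j => contr H (fun k l => h i j k l)).
have scE D0 : scalar_curvature g D0 p e =
  cc (fun i j k l => curv4 g D0 p (e k) (e i) (e j) (e l)) by [].
have eq_cc h h' : (forall i j k l, h i j k l = h' i j k l) -> cc h = cc h'.
  by move=> hh; apply: eq_contr => i j; apply: eq_contr => k l; exact: hh.
have ccD h h' : cc (fun i j k l => h i j k l + h' i j k l) = cc h + cc h'.
  by rewrite /cc -contrD; apply: eq_contr => i j; rewrite -contrD.
have ccN h : cc (fun i j k l => - h i j k l) = - cc h.
  by rewrite /cc -contrN; apply: eq_contr => i j; rewrite -contrN.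
have ccX h : cc h = cc (fun i j k l => h k l i j) by exact: contr_exchange.
have cc_sym1 h : cc h = cc (fun i j k l => h j i k l) by exact: contr_sym.
have cc_sym2 h : cc h = cc (fun i j k l => h i j l k).
  by apply: eq_contr => i j; exact: contr_sym.
have cc_skew2 h : (forall i j k l, h i j k l = - h i j l k) -> cc h = 0.
  move=> hN; have : cc h = - cc h by rewrite {1}cc_sym2 -ccN; apply: eq_cc.
  lra.
have cc_skew1 h : (forall i j k l, h i j k l = - h j i k l) -> cc h = 0.
  by move=> hN; rewrite ccX cc_skew2 // => i j k l; exact: hN.
(* The skew indices are contracted together: i with j here, k with l in [z2]. *)
have z1 : cc (fun i j k l => s k i j l) = 0 by apply: cc_skew1.
have z2 : cc (fun i j k l => - s i k j l) = 0.
  by rewrite ccN cc_skew2 ?oppr0.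
have z3 : cc (fun i j k l => - (g p (S i j) (G' k l) + g p (G i j) (S k l))) = 0.
  rewrite ccN ccD cc_skew1 => [|i j k l]; last by rewrite SN (ipNl gl).
  rewrite cc_skew2 => [|i j k l]; last by rewrite SN (ipNr gl gs).
  by rewrite addr0 oppr0.
(* After renaming, the skew [S] is contracted in both slots against the symmetric [G]. *)
have z4 : cc (fun i j k l => g p (S k j) (G i l)) = 0.
  rewrite cc_sym1; set u := fun i j k l => _.
  have : cc u = - cc u.
    rewrite {1}ccX -ccN; apply: eq_cc => i j k l.
    by rewrite /u SN (ipNl gl) GC.
  lra.
have z5 : cc (fun i j k l => g p (S i l) (G k j)) = 0.
  by rewrite ccX.
(* One flip of [S] aligns the indices and produces the sign; Parseval supplies the third
   contraction. *)
have z6 : cc (fun i j k l => g p (S k j) (S i l)) = - ip3 H S3 S3.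
  rewrite cc_sym2 -ccN; apply: eq_cc => i j k l.
  rewrite SN (ipNl gl) gs; congr (- _).
  by rewrite -(parseval gl gs gp be).
rewrite !scE (eq_cc _ _ curvE) ccD; set c := cc _.
rewrite !(ccD, z1, z2, z3, z4, z5, z6); lra.
Qed.

End TorsionDifference.

(** * Pointwise identities for the covariant derivative of [P] *)

Section NablaP.
Variables (D : connection M) (P : tensor11 M).
Hypotheses (hP : almost_product g P) (gD : parallel_metric D g).

Lemma ipP p x y : g p (P p x) y = g p x (P p y).
Proof. exact: ipPl (hP.1 p) (hP.2 p) x y. Qed.

(** Differentiate g(PY, Z) = g(Y, PZ). *)
Lemma nablaP_sym p v Y Z : smooth_field_at p Y -> smooth_field_at p Z ->
  g p (nablaP D P p v Y) (Z p) = g p (Y p) (nablaP D P p v Z).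
Proof.
move=> sY sZ.
have sPY := tensor11_smooth P sY; have sPZ := tensor11_smooth P sZ.
have := gD v sPY sZ; have := gD v sY sPZ.
have -> : (fun q => g q (P q (Y q)) (Z q)) = (fun q => g q (Y q) (P q (Z q))).
  by apply/funext => q; rewrite ipP.
by rewrite /nablaP gB gBr !ipP; lra.
Qed.

(** By [nablaP_sym] the pairing with any vector involves [Y] only through its value at [p], and [g]
    is nondegenerate. *)
Lemma nablaP_tensorial p v Y : smooth_field_at p Y ->
  nablaP D P p v Y = nablaP D P p v (extend p (Y p)).
Proof.
move=> sY; apply: (ip_inj (@metric_linear _ _ _ g p) (@metric_pos _ _ _ g p)) => w.
have sw := smooth_extend p w; have sY' := smooth_extend p (Y p).
have := nablaP_sym v sY sw; have := nablaP_sym v sY' sw.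
by rewrite !extend_at => -> ->.
Qed.

(** This is the derivative of P^2 = 1. *)
Lemma nablaP_P p v Y : smooth_field_at p Y ->
  nablaP D P p v (app_field P Y) = - P p (nablaP D P p v Y).
Proof.
move=> sY; rewrite /nablaP /app_field.
have -> : (fun q => P q (P q (Y q))) = Y by apply/funext => q; rewrite hP.1.
by rewrite linearB /= hP.1 opprB.
Qed.

End NablaP.
End Connections.

Theorem proposition2p4 (R : realType) (n : nat) (M : manifold R n)
    (g : metric M) (P : tensor11 M) (D D' : connection M)
    (hP : almost_product g P) (htr : traceless P)
    (hD : levi_civita g D) (hW3 : W3 g P D) (hD' : RPT g P D')
    (hT : forall (p : M) (X Y Z : vfield M),
      smooth_field_at p X -> smooth_field_at p Y -> smooth_field_at p Z ->
      torsion3 g D' X Y Z p =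
        2^-1 * (tensorF g P D X Y (app_field P Z) p
                + tensorF g P D Y Z (app_field P X) p
                + tensorF g P D Z X (app_field P Y) p))
    (p : M) (e : 'I_n -> 'rV[R]_n) (he : is_basis e) :
  scalar_curvature g D p e =
    scalar_curvature g D' p e + 3 / 8 * sqnorm_nablaP g P D p e.
Proof.
have [_ gD' T3] := hD'; have [gD _] := hD.
have gl := @metric_linear _ _ _ g p; have gs := Defs.metric_sym g p.
have gp := @metric_pos _ _ _ g p.
rewrite (scalar_curvature_diff hD gD' T3 p he).
pose N x y := nablaP D P p x (extend p y).
pose S x y := D' p x (extend p y) - D p x (extend p y).
have sm u := smooth_extend p u.
have N_sym x y z : g p (N x y) z = g p y (N x z).
  by have := nablaP_sym hP gD x (sm y) (sm z); rewrite !extend_at.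
have N_P x y : N x (P p y) = - P p (N x y).
  rewrite /N -(nablaP_P D hP) //.
  (* [P] applied to the extension of [y] and the extension of [P p y] are only known to agree at
     [p], which suffices by tensoriality. *)
  rewrite (nablaP_tensorial hP gD x (tensor11_smooth P (sm y))).
  by rewrite /app_field extend_at.
have N_cycle x y z : g p (N x y) z + g p (N y z) x + g p (N z x) y = 0.
  by have := hW3 p _ _ _ (sm x) (sm y) (sm z); rewrite /tensorF !extend_at.
have S_N x y z : g p (S x y) z =
    4^-1 * (g p (N x y) (P p z) + g p (N y z) (P p x) + g p (N z x) (P p y)).
  rewrite /S (ipBl gl).
  have := metric_connection_diff hD gD' T3 (sm x) (sm y) (sm z).
  rewrite hT // /tensorF /app_field !extend_at => ->.
  by rewrite /N; lra.
congr (_ + _).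
rewrite (ip3_torsion gl gs gp he (hP.1 p) (hP.2 p) N_sym N_P N_cycle S_N).
(* The square norm has two explicit contractions; the third one of [ip3] collapses by Parseval. *)
congr (_ * _); rewrite /sqnorm_nablaP /ip3 /contr.
apply: eq_bigr => i _; apply: eq_bigr => j _; rewrite mulr_sumr.
apply: eq_bigr => k _; rewrite mulr_sumr; apply: eq_bigr => s _.
by rewrite -mulrA; congr (_ * (_ * _)); exact: parseval.
Qed.
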